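(* Let $S_1,S_2$ be rooted plane trees such that $S_1\subseteq S_2$. Then for all sufficiently large odd $n$, $$\frac{g_{\mathcal{B}_n}(S_1)}{a_{\mathcal{B}_n}(S_1)}\le\frac{g_{\mathcal{B}_n}(S_2)}{a_{\mathcal{B}_n}(S_2)}.$$
   Context: $\mathcal{B}_n$ is the set of plane (ordered) binary trees with $n$ nodes (every node has $0$ or $2$ children, order of children matters); it is empty for even $n$. A rooted tree is viewed as a poset with $v\le w$ iff $w$ is an ancestor of $v$ or equal to it. For incomparable vertices $x,y$ of a plane tree, $x$ is left of $y$ if at their lowest common ancestor the child leading to $x$ precedes the child leading to $y$. A (plane) embedding of a plane tree $S$ into a plane tree $T$ is a vertex subset $E$ of $T$ whose induced subposet is isomorphic to $S$ via an isomorphism preserving the left-to-right order of children of each vertex of $S$; it is good if $E$ contains the root of $T$. $S\subseteq T$ means there is at least one embedding of $S$ into $T$. $a_{\mathcal{B}_n}(S)$ (resp. $g_{\mathcal{B}_n}(S)$) is the total number of embeddings (resp. good embeddings) of $S$ into all trees of $\mathcal{B}_n$. *)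

(* Defs.v *)
From mathcomp Require Import all_boot all_order all_algebra.
From Stdlib Require List.
Set Implicit Arguments. Unset Strict Implicit. Unset Printing Implicit Defensive.

(* Rooted plane (ordered) trees: a node with an ordered list of children.
   Structural equality of ptree = isomorphism of plane trees. *)
Inductive ptree := Node of seq ptree.

(* Vertices are addressed by paths from the root: [::] is the root, and
   p ++ [:: i] is the i-th child (0-based) of the vertex p. *)
Fixpoint verts (t : ptree) : seq (seq nat) :=
  let: Node ts := t in
  [::] :: (fix vs (i : nat) (ts : seq ptree) : seq (seq nat) :=
             match ts with
             | [::] => [::]
             | t' :: ts' => map (cons i) (verts t') ++ vs i.+1 ts'
             end) 0 ts.

Definition nnodes (t : ptree) : nat := size (verts t).

Fixpoint is_full_binary (t : ptree) : bool :=
  let: Node ts := t in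
  ((size ts == 0) || (size ts == 2)) && all is_full_binary ts.

(* Poset order: v <= w iff w is an ancestor of v or equal, i.e. the path of
   w is a prefix of the path of v. *)
Definition tle (v w : seq nat) : bool := prefix w v.

(* x is left of y: at their lowest common ancestor the child leading to x
   precedes the child leading to y (false if x, y are comparable). *)
Fixpoint left_of (x y : seq nat) : bool :=
  match x, y with
  | i :: x', j :: y' => (i < j) || ((i == j) && left_of x' y')
  | _, _ => false
  end.

Definition sibling_before (u v : seq nat) : bool :=
  [&& size u == size v, 0 < size u,
      take (size u).-1 u == take (size v).-1 v &
      last 0 u < last 0 v].

(* ws (aligned with vs = verts S) gives a bijection V(S) -> E which is an
   isomorphism of posets preserving the left-to-right order of children. *)
Definition iso_ok (vs ws : seq (seq nat)) : bool :=
  all (fun i => all (fun j =>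
         (tle (nth [::] vs i) (nth [::] vs j) == tle (nth [::] ws i) (nth [::] ws j))
         && (sibling_before (nth [::] vs i) (nth [::] vs j) ==>
               left_of (nth [::] ws i) (nth [::] ws j)))
       (iota 0 (size vs))) (iota 0 (size vs)).

(* E (a set of vertices of T, given as a duplicate-free list) is a plane
   embedding of S into T: some bijection from V(S) onto E is an order
   isomorphism preserving the order of children. *)
Definition is_embedding (S : ptree) (E : seq (seq nat)) : bool :=
  (size E == size (verts S)) && has (iso_ok (verts S)) (permutations E).

Fixpoint subseqs (A : Type) (s : seq A) : seq (seq A) :=
  match s with
  | [::] => [:: [::]]
  | x :: s' => let r := subseqs s' in map (cons x) r ++ r
  end.

(* the embeddings of S into T (each vertex subset listed once) *)
Definition embeddings (S T : ptree) : seq (seq (seq nat)) :=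
  filter (is_embedding S) (subseqs (verts T)).

Definition n_emb (S T : ptree) : nat := size (embeddings S T).
Definition n_good_emb (S T : ptree) : nat :=
  count (fun E => [::] \in E) (embeddings S T).

Definition contained (S T : ptree) : Prop := 0 < n_emb S T.

Definition a_count (B : seq ptree) (S : ptree) : nat := \sum_(T <- B) n_emb S T.
Definition g_count (B : seq ptree) (S : ptree) : nat := \sum_(T <- B) n_good_emb S T.

Definition enumerates_B (n : nat) (Bn : seq ptree) : Prop :=
  List.NoDup Bn /\
  (forall T, List.In T Bn <-> (is_full_binary T /\ nnodes T = n)).

(* Main.v *)
Require Import Defs.
From HB Require Import structures.
From mathcomp Require Import all_boot all_order all_algebra.
From mathcomp Require Import boolp.
From mathcomp Require Import zify ring lra.
Import Order.TTheory GRing.Theory Num.Theory.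
Set Implicit Arguments. Unset Strict Implicit. Unset Printing Implicit Defensive.

(** Let [x] mark the internal nodes of a full binary tree and put
    [s = sqrt (1 - 4 x)]. The generating functions of the binary trees, and of
    the embeddings of forests into them, satisfy quadratic recurrences obtained
    by cutting the host tree at its root; solving them shows that, for a
    constant [K > 0] depending only on [S], the good embeddings and all
    embeddings of [S] have generating functions
      [K x^-1 s^-(p-1) (1-s)^q]  and  [K x^-1 s^-p (1-s)^q],
    where [p + 1] is the number of nodes plus the number of leaves of [S].
    With [c_p(n) = [x^n] s^-p], the ratio is asymptotic to
    [c_(p-1)(n) / c_p(n)], and the log-concavity of [p |-> c_p(n)] has a
    multiplicative gap that does not depend on [n]. So the larger [p] wins for
    large [n]; and if [S1] embeds into [S2], then [p1 < p2] unless [S1 = S2]. *)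

(** * Embeddings and prefix patterns *)

(** Induction on a tree has to pass through the list of its children; [Q] carries the hypothesis
    along that list. *)
Section ForestInduction.
Variables (P : ptree -> Prop) (Q : seq ptree -> Prop).
Hypothesis hN : forall ts, Q ts -> P (Node ts).
Hypothesis h0 : Q [::].
Hypothesis hC : forall t ts, P t -> Q ts -> Q (t :: ts).

Fixpoint ptree_forest_ind (t : ptree) : P t :=
  let: Node ts := t in
  hN ((fix f (ts : seq ptree) : Q ts :=
    if ts is t' :: ts' then hC (ptree_forest_ind t') (f ts') else h0) ts).

Lemma forest_ptree_ind (ts : seq ptree) : Q ts.
Proof. by elim: ts => [|t ts IH]; [exact: h0 | apply: hC IH; exact: ptree_forest_ind]. Qed.

End ForestInduction.

(** The inner loop of [verts] as a function of its own; [i] is the index of the first tree among its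
    siblings. *)
Fixpoint fverts (i : nat) (ts : seq ptree) : seq (seq nat) :=
  if ts is t :: ts' then map (cons i) (verts t) ++ fverts i.+1 ts' else [::].

Lemma vertsE ts : verts (Node ts) = [::] :: fverts 0 ts.
Proof. by []. Qed.

(** The order of depth-first traversal: a vertex comes after its ancestors and after all vertices to
    its left. *)
Fixpoint lexlt (x y : seq nat) : bool :=
  match x, y with
  | _, [::] => false
  | [::], _ :: _ => true
  | i :: x', j :: y' => (i < j) || ((i == j) && lexlt x' y')
  end.

Lemma lexlt_irr : irreflexive lexlt.
Proof. by elim=> //= i x ->; rewrite ltnn eqxx. Qed.

Lemma lexlt_trans : transitive lexlt.
Proof.
elim=> [|j y IH] [|i x] [|k z] //=.
case/orP=> [lij|/andP[/eqP-> xy]]; case/orP=> [ljk|/andP[/eqP<- yz]].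
- by rewrite (ltn_trans lij ljk).
- by rewrite lij.
- by rewrite ljk.
- by rewrite eqxx (IH _ _ xy yz) orbT.
Qed.

Lemma lexlt_asym x y : lexlt x y -> lexlt y x = false.
Proof.
by move=> xy; apply/negP=> yx; have := lexlt_trans xy yx; rewrite lexlt_irr.
Qed.

Lemma lexltE x y : lexlt x y = ~~ prefix y x && (prefix x y || left_of x y).
Proof.
elim: x y => [|i x IH] [|j y] //=; rewrite ?prefix_cons ?andbF //.
rewrite IH eq_sym; case: (ltngtP i j) => //= _.
Qed.

Lemma left_of_prefixF x y : left_of x y -> prefix x y = false /\ prefix y x = false.
Proof.
elim: x y => [|i x IH] [|j y] //=; rewrite ?prefix_cons.
rewrite (eq_sym j i); case: (ltngtP i j) => //= _; exact: IH.
Qed.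

Lemma left_of_lexlt x y : left_of x y -> lexlt x y.
Proof. by move=> l; rewrite lexltE l orbT andbT; case: (left_of_prefixF l) => _ ->. Qed.

Lemma left_of_below u v x y :
  left_of u v -> prefix u x -> prefix v y -> left_of x y.
Proof.
elim: u v x y => [|i u IH] [|j v] [|k x] [|l y] //=; rewrite ?prefix_cons.
move=> h /andP[/eqP<- ux] /andP[/eqP<- vy].
case/orP: h => [->//|/andP[-> uv]]; by rewrite (IH _ _ _ uv ux vy) orbT.
Qed.

Lemma sibling_before_left_of u v : sibling_before u v -> left_of u v.
Proof.
case/and4P=> /eqP sz u0.
rewrite -sz; elim/last_ind: u sz u0 => // u a _; elim/last_ind: v => // v b _.
rewrite !size_rcons => -[sz] _; rewrite -!cats1 !last_cat /= take_size_cat //.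
rewrite sz take_size_cat // => /eqP -> lab.
elim: v {sz u} => /= [|i v ->]; by rewrite ?lab // eqxx orbT.
Qed.

(** The witnesses are the prefixes of [x] and [y] one step below their lowest common ancestor.
    Siblings are the only pairs whose horizontal order [iso_ok] tests. *)
Lemma left_of_siblings x y : left_of x y ->
  exists u v, [/\ prefix u x, prefix v y & sibling_before u v].
Proof.
elim: x y => [|i x IH] [|j y] //=; case/orP=> [lij|/andP[/eqP<- /IH]].
  by exists [:: i], [:: j]; rewrite /sibling_before /= !eqxx !prefix0s lij.
move=> [u [v [ux vy /and4P[sz u0 tk ls]]]]; exists (i :: u), (i :: v).
rewrite /= !eqxx ux vy; split=> //.
case: u u0 sz tk ls {ux} => // a u _; case: v {vy} => // b v.
by rewrite /sibling_before /= !eqSS eqseq_cons eqxx => -> -> ->.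
Qed.

Lemma fverts_cons i ts x : x \in fverts i ts -> exists k x', x = k :: x' /\ i <= k.
Proof.
elim: ts i => //= t ts IH i; rewrite mem_cat => /orP[/mapP[x' _ ->]|/IH].
  by exists i, x'.
by move=> [k [x' [-> lik]]]; exists k, x'; split=> //; exact: ltnW.
Qed.

Lemma verts_pairwise t : pairwise lexlt (verts t).
Proof.
pose Q ts := forall i, pairwise lexlt (fverts i ts).
apply: (@ptree_forest_ind (fun t => pairwise lexlt (verts t)) Q) t => [ts IH|//|t ts IH IHs i] /=.
  rewrite -/(fverts 0 ts) IH andbT; apply/allP=> x /fverts_cons [k [x' [-> _]]] //.
rewrite pairwise_cat IHs andbT; apply/andP; split; last first.
  by rewrite pairwise_map; apply: sub_pairwise IH => x y /= ->; rewrite eqxx orbT.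
apply/allrelP=> x y /mapP[x' _ ->] /fverts_cons[k [y' [-> lik]]] /=.
by rewrite lik.
Qed.

Lemma verts_prefix t u x : x \in verts t -> prefix u x -> u \in verts t.
Proof.
pose Q ts := forall i u x, x \in fverts i ts -> prefix u x -> u != [::] ->
  u \in fverts i ts.
pose P t := forall u x, x \in verts t -> prefix u x -> u \in verts t.
apply: (@ptree_forest_ind P Q) t u x => [ts IH u x|//|t ts IH IHs i u x] /=.
  rewrite -/(fverts 0 ts) !in_cons; have [-> //|u0] := eqVneq u [::].
  case/orP=> [/eqP->|]; first by rewrite prefixs0 (negbTE u0).
  by move=> /IH h /h; apply.
rewrite !mem_cat => /orP[/mapP[x' xt ->]|xts ux u0]; last first.
  by rewrite (IHs _ _ _ xts ux u0) orbT.
case: u => // a u; rewrite prefix_cons => /andP[/eqP-> ux] _.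
by rewrite map_f ?(IH _ _ xt ux).
Qed.

(* On lists of vertices sorted in preorder, [is_embedding] only depends on the
   pattern of ancestor relations: two vertices [x] before [y] are either
   comparable, with [x] above [y], or [x] is left of [y]. *)
Fixpoint pattern (E : seq (seq nat)) : seq (seq bool) :=
  if E is x :: E' then map (prefix x) E' :: pattern E' else [::].

Lemma size_pattern E : size (pattern E) = size E.
Proof. by elim: E => //= x E ->. Qed.

Lemma pattern_eqP (vs ws : seq (seq nat)) : size vs = size ws ->
  (pattern vs = pattern ws <->
   forall i j, i < j < size vs ->
     prefix (nth [::] vs i) (nth [::] vs j) = prefix (nth [::] ws i) (nth [::] ws j)).
Proof.
elim: vs ws => [|v vs IH] [|w ws] //= [sz].
split=> [[e1 /(IH _ sz) e2] [|i] [|j] //=|h].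
- rewrite ltnS => lj; have /= := congr1 (nth false ^~ j) e1.
  by rewrite !(nth_map [::]) -?sz.
- by rewrite !ltnS; exact: e2.
congr cons; last by apply/(IH _ sz) => i j h'; exact: (h i.+1 j.+1).
apply: (@eq_from_nth _ false); rewrite !size_map // => j lj.
by rewrite !(nth_map [::]) -?sz //; exact: (h 0 j.+1).
Qed.

Lemma pairwise_lexlt_nth E i j : pairwise lexlt E -> i < j < size E ->
  lexlt (nth [::] E i) (nth [::] E j).
Proof. by move=> /(pairwiseP [::]) h /andP[lij lj]; apply: h => //; exact: ltn_trans lj. Qed.

Lemma iso_okP vs ws : reflect
  (forall i j, i < size vs -> j < size vs ->
     tle (nth [::] vs i) (nth [::] vs j) = tle (nth [::] ws i) (nth [::] ws j) /\
     (sibling_before (nth [::] vs i) (nth [::] vs j) ->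
       left_of (nth [::] ws i) (nth [::] ws j)))
  (iso_ok vs ws).
Proof.
apply: (iffP allP) => h => [i j li lj|i].
  have /h/allP/(_ j) : i \in iota 0 (size vs) by rewrite mem_iota.
  by rewrite mem_iota /= => /(_ lj)/andP[/eqP-> /implyP].
rewrite mem_iota => /= li; apply/allP=> j; rewrite mem_iota /= => lj.
by have [-> e] := h i j li lj; rewrite eqxx; apply/implyP.
Qed.

(** In a sorted list, an earlier vertex that is not above a later one is to its left, so the prefix
    relations decide everything that [iso_ok] tests. *)
Lemma iso_ok_sorted vs E : size E = size vs ->
  pairwise lexlt vs -> pairwise lexlt E -> pattern E = pattern vs -> iso_ok vs E.
Proof.
move=> sz pv pE /(pattern_eqP sz) pat; apply/iso_okP=> i j li lj.
rewrite /tle; case: (ltngtP i j) => [lij|lji|<-].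
- have vlt : lexlt (nth [::] vs i) (nth [::] vs j).
    by apply: pairwise_lexlt_nth => //; rewrite lij.
  have elt : lexlt (nth [::] E i) (nth [::] E j).
    by apply: pairwise_lexlt_nth => //; rewrite lij sz.
  have := pat i j; rewrite lij sz lj => /(_ isT) e.
  move: (vlt) (elt); rewrite !lexltE => /andP[/negbTE-> v1] /andP[/negbTE-> e1].
  split=> // /sibling_before_left_of/left_of_prefixF[h _].
  by move: e1; rewrite e h.
- have vlt : lexlt (nth [::] vs j) (nth [::] vs i).
    by apply: pairwise_lexlt_nth => //; rewrite lji.
  rewrite -pat ?lji ?sz //; split=> // /sibling_before_left_of/left_of_lexlt.
  by rewrite lexlt_asym.
- by rewrite !prefix_refl; split=> // /sibling_before_left_of/left_of_lexlt; rewrite lexlt_irr.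
Qed.

(** Ancestors are preserved by [tle]; if two vertices of [S] are incomparable, the siblings above
    them keep their order, and so do their descendants. Hence the only possible isomorphism lists
    its image in depth-first order. *)
Lemma iso_ok_pairwise S ws : size ws = size (verts S) -> iso_ok (verts S) ws ->
  pairwise lexlt ws.
Proof.
move=> sz /iso_okP iso; apply/(pairwiseP [::]) => i j.
rewrite !inE sz => li lj lij.
have : lexlt (nth [::] (verts S) i) (nth [::] (verts S) j).
  by apply: pairwise_lexlt_nth (verts_pairwise S) _; rewrite lij.
rewrite !lexltE => /andP[]; have [e1 _] := iso j i lj li; have [e2 _] := iso i j li lj.
rewrite /tle in e1 e2; rewrite e1 e2.
case: (boolP (prefix (nth [::] ws i) (nth [::] ws j))) => [_ -> //|_ _ /=].
move=> /left_of_siblings [u [v [ui vj sib]]].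
have uS : u \in verts S by apply: verts_prefix ui; rewrite mem_nth.
have vS : v \in verts S by apply: verts_prefix vj; rewrite mem_nth.
have iu : index u (verts S) < size (verts S) by rewrite index_mem.
have iv : index v (verts S) < size (verts S) by rewrite index_mem.
have [_] := iso _ _ iu iv; rewrite !nth_index // => /(_ sib) l.
have h : left_of (nth [::] ws i) (nth [::] ws j).
  apply: left_of_below l _ _.
    by have [+ _] := iso i _ li iu; rewrite /tle nth_index // => <-.
  by have [+ _] := iso j _ lj iv; rewrite /tle nth_index // => <-.
by have [_ ->] := left_of_prefixF h.
Qed.

Lemma is_embeddingE S E : pairwise lexlt E ->
  is_embedding S E = (pattern E == pattern (verts S)).
Proof.
move=> pE; apply/andP/eqP => [[/eqP sz /hasP[ws]]|pat].
  rewrite mem_permutations => pe iso.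
  have szw : size ws = size (verts S) by rewrite (perm_size pe).
  have pw := iso_ok_pairwise szw iso.
  have <- : ws = E.
    apply: (irr_sorted_eq lexlt_trans lexlt_irr) (pairwise_sorted pw) (pairwise_sorted pE) _.
    exact: perm_mem.
  apply/(pattern_eqP szw) => i j /andP[lij lj]; rewrite szw in lj.
  by have [+ _] := (iso_okP _ _ iso) j i lj (ltn_trans lij lj).
have sz : size E = size (verts S) by rewrite -size_pattern pat size_pattern.
split; first exact/eqP; apply/hasP; exists E; first by rewrite mem_permutations.
exact: iso_ok_sorted (verts_pairwise S) pE pat.
Qed.

(** Patterns are upper triangular. When no vertex of the first list is above one of the second,
    joining the lists adds a block of [false]. *)
Definition pcat (P Q : seq (seq bool)) : seq (seq bool) :=
  [seq r ++ nseq (size Q) false | r <- P] ++ Q.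

Lemma size_pcat P Q : size (pcat P Q) = size P + size Q.
Proof. by rewrite size_cat size_map. Qed.

Lemma pcatA P Q R : pcat P (pcat Q R) = pcat (pcat P Q) R.
Proof.
rewrite /pcat map_cat -catA -map_comp; congr cat.
by apply: eq_map => r /=; rewrite -catA size_cat size_map -nseqD.
Qed.

Lemma pcat_inj P Q P' Q' : size P = size P' -> size Q = size Q' ->
  pcat P Q = pcat P' Q' -> P = P' /\ Q = Q'.
Proof.
move=> sP sQ /eqP; rewrite /pcat sQ eqseq_cat ?size_map // => /andP[/eqP eP /eqP->].
split=> //; move: eP; apply: inj_map => r r' /(congr1 rev); rewrite !rev_cat.
by move/eqP; rewrite eqseq_cat // eqxx => /eqP /(can_inj revK).
Qed.

Lemma pattern_cat E1 E2 : (forall x y, x \in E1 -> y \in E2 -> ~~ prefix x y) ->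
  pattern (E1 ++ E2) = pcat (pattern E1) (pattern E2).
Proof.
elim: E1 => //= x E1 IH h; rewrite IH /pcat /= => [|y z yE zE]; last first.
  by apply: h => //; rewrite in_cons yE orbT.
congr cons; rewrite map_cat size_pattern; congr cat.
apply: (@eq_from_nth _ false); rewrite size_map ?size_nseq // => i li.
rewrite nth_nseq li (nth_map [::]) //; apply/negbTE/h; first exact: mem_head.
exact: mem_nth.
Qed.

Lemma pattern_map_cons i E : pattern (map (cons i) E) = pattern E.
Proof.
elim: E => //= x E ->; congr cons; rewrite -map_comp.
by apply: eq_map => y /=; rewrite eqxx.
Qed.

Lemma pattern_root E : pattern ([::] :: E) = nseq (size E) true :: pattern E.
Proof.
rewrite /=; congr cons; elim: E => //= x E ->; by rewrite prefix0s.
Qed.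

Lemma fverts_disjoint i V ts x y :
  x \in map (cons i) V -> y \in fverts i.+1 ts -> ~~ prefix x y.
Proof.
case/mapP=> x' _ -> /fverts_cons[k [y' [-> lik]]] /=.
by rewrite ltn_eqF.
Qed.

Fixpoint fpat (ts : seq ptree) : seq (seq bool) :=
  if ts is t :: ts' then pcat (pattern (verts t)) (fpat ts') else [::].

Lemma pattern_fverts i ts : pattern (fverts i ts) = fpat ts.
Proof.
elim: ts i => //= t ts IH i.
by rewrite (pattern_cat (@fverts_disjoint _ _ _)) pattern_map_cons IH.
Qed.

Lemma fpat_cons us ts : fpat (Node us :: ts) =
  pcat (nseq (size (fpat us)) true :: fpat us) (fpat ts).
Proof.
rewrite -[LHS]/(pcat (pattern (verts (Node us))) (fpat ts)) vertsE pattern_root.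
by rewrite pattern_fverts -(pattern_fverts 0 us) size_pattern.
Qed.

Lemma fpat1 t : fpat [:: t] = pattern (verts t).
Proof.
by rewrite /= /pcat cats0 -[RHS]map_id; apply: eq_map => r; rewrite cats0.
Qed.

Lemma fpat_cat f g : fpat (f ++ g) = pcat (fpat f) (fpat g).
Proof. by elim: f => //= t f ->; rewrite pcatA. Qed.

(** The number of [true] in the first row is the number of proper descendants of the first root. So
    a pattern tells where its first tree ends and can be split there. *)
Lemma fpat_inj : injective fpat.
Proof.
pose Q ts := forall ts', fpat ts = fpat ts' -> ts = ts'.
pose P t := let: Node us := t in Q us.
apply: (@forest_ptree_ind P Q) => [//||[us] ts IHu IH] [|[us'] ts'] //;
  rewrite ?fpat_cons // => e.
have e1 := congr1 (fun s => count id (head [::] s)) e.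
rewrite /= !count_cat !count_nseq /= !mul0n !mul1n !addn0 in e1.
have e2 := congr1 size e; rewrite !size_pcat /= e1 in e2.
have /addnI sz := e2.
have sz' : (size (fpat us)).+1 = (size (fpat us')).+1 by rewrite e1.
have [[_ eu] et] := pcat_inj (P := _ :: _) (P' := _ :: _) sz' sz e.
by rewrite (IHu _ eu) (IH _ et).
Qed.

Lemma tpat_inj : injective (fun t => fpat [:: t]).
Proof. by move=> t u /fpat_inj []. Qed.

HB.instance Definition _ := Equality.copy ptree (inj_type tpat_inj).

(** The plane forests induced on the vertex subsets, with multiplicity and in the order of
    [subseqs (verts t)]: a kept root sits above all that is kept below it, and without the root
    those parts stand side by side. *)
Fixpoint subforests (t : ptree) : seq (seq ptree) :=
  let: Node ts := t in
  let r := (fix ff (ts : seq ptree) : seq (seq ptree) :=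
    if ts is t' :: ts' then [seq f ++ g | f <- subforests t', g <- ff ts']
    else [:: [::]]) ts in
  [seq [:: Node f] | f <- r] ++ r.

Fixpoint fsubforests (ts : seq ptree) : seq (seq ptree) :=
  if ts is t :: ts' then [seq f ++ g | f <- subforests t, g <- fsubforests ts']
  else [:: [::]].

Lemma subforestsE ts : subforests (Node ts) =
  [seq [:: Node f] | f <- fsubforests ts] ++ fsubforests ts.
Proof. by []. Qed.

Lemma subseqs_cat (A : Type) (s1 s2 : seq A) :
  subseqs (s1 ++ s2) = [seq e1 ++ e2 | e1 <- subseqs s1, e2 <- subseqs s2].
Proof.
elim: s1 => [|x s1 IH] /=; first by rewrite cats0 map_id.
by rewrite IH allpairs_cat map_allpairs allpairs_mapl.
Qed.

Lemma subseqs_map (A B : Type) (h : A -> B) s :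
  subseqs (map h s) = map (map h) (subseqs s).
Proof. by elim: s => //= x s ->; rewrite map_cat -!map_comp. Qed.

Lemma subseqs_subseq (A : eqType) (s e : seq A) : e \in subseqs s -> subseq e s.
Proof.
elim: s e => [|x s IH] e /=; first by rewrite inE => /eqP->.
rewrite mem_cat => /orP[/mapP[e' /IH h ->]|/IH h]; first by rewrite /= eqxx.
exact: subseq_trans h (subseq_cons _ _).
Qed.

Lemma map_pattern_subseqs_node ts :
  map pattern (subseqs (fverts 0 ts)) = map fpat (fsubforests ts) ->
  map pattern (subseqs (verts (Node ts))) = map fpat (subforests (Node ts)).
Proof.
move=> IH; rewrite subforestsE vertsE map_cat -IH /= map_cat; congr cat.
transitivity [seq nseq (size p) true :: p | p <- map pattern (subseqs (fverts 0 ts))].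
  rewrite -!map_comp; apply: eq_map => E; rewrite /comp pattern_root.
  by rewrite size_pattern.
rewrite IH -!map_comp; apply: eq_map => f.
by rewrite /comp fpat1 vertsE pattern_root -(pattern_fverts 0) size_pattern.
Qed.

Lemma map_pattern_fsubseqs i ts :
  map pattern (subseqs (fverts i ts)) = map fpat (fsubforests ts).
Proof.
pose Q ts := forall i,
  map pattern (subseqs (fverts i ts)) = map fpat (fsubforests ts).
pose P t := map pattern (subseqs (verts t)) = map fpat (subforests t).
apply: (@forest_ptree_ind P Q) ts i => [ts IH|//|t ts IH IHs i].
  exact: map_pattern_subseqs_node.
rewrite /= subseqs_cat !map_allpairs subseqs_map.
transitivity [seq pcat p q | p <- map pattern (subseqs (verts t)),
    q <- map pattern (subseqs (fverts i.+1 ts))]; last first.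
  rewrite IH IHs allpairs_mapl allpairs_mapr.
  by apply: eq_allpairs => // f g; rewrite fpat_cat.
rewrite !allpairs_mapl allpairs_mapr; apply/eq_in_allpairs_dep => e1 h1 e2 h2.
rewrite pattern_cat ?pattern_map_cons // => x y xe ye.
apply: (@fverts_disjoint i (verts t) ts).
  by apply: (mem_subseq (s1 := map (cons i) e1)) => //; apply/map_subseq/subseqs_subseq.
exact: (mem_subseq (subseqs_subseq h2)).
Qed.

Lemma map_pattern_subseqs t :
  map pattern (subseqs (verts t)) = map fpat (subforests t).
Proof. by case: t => ts; apply/map_pattern_subseqs_node/map_pattern_fsubseqs. Qed.

Lemma count_is_embedding S T V : subseq V (verts T) ->
  count (is_embedding S) (subseqs V) =
  count (pred1 (fpat [:: S])) (map pattern (subseqs V)).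
Proof.
move=> sub; rewrite count_map; apply: eq_in_count => E /subseqs_subseq h.
rewrite -[RHS]/(pattern E == fpat [:: S]) fpat1; apply: is_embeddingE.
exact: subseq_pairwise (subseq_trans h sub) (verts_pairwise T).
Qed.

Lemma n_embE S T : n_emb S T = count_mem [:: S] (subforests T).
Proof.
rewrite /n_emb /embeddings size_filter (count_is_embedding _ (subseq_refl _)).
rewrite map_pattern_subseqs count_map; apply: eq_count => f.
exact: (inj_eq fpat_inj).
Qed.

(** The root of the host, once kept, is the image of the root of the pattern, and the other vertices
    must induce the forest of its children. *)
Lemma n_good_embE ss ts : n_good_emb (Node ss) (Node ts) = count_mem ss (fsubforests ts).
Proof.
rewrite /n_good_emb /embeddings count_filter vertsE [subseqs _]/= count_cat.
rewrite [X in _ + X](_ : _ = 0) ?addn0; last first.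
  apply/eqP; rewrite -leqn0 leqNgt -has_count; apply/hasPn => E /subseqs_subseq h.
  rewrite negb_and; apply/orP; left; apply/negP => /(mem_subseq h).
  by case/fverts_cons => k [x' []].
rewrite count_map.
transitivity (count (pred1 (fpat ss)) (map pattern (subseqs (fverts 0 ts)))).
  rewrite count_map; apply: eq_in_count => E /subseqs_subseq h.
  rewrite -[LHS]/(([::] \in [::] :: E) && is_embedding (Node ss) ([::] :: E)).
  rewrite -[RHS]/(pattern E == fpat ss) mem_head andTb is_embeddingE.
    rewrite pattern_root vertsE pattern_root pattern_fverts eqseq_cons.
    rewrite -(size_pattern (fverts 0 ss)) pattern_fverts -(size_pattern E).
    by case: (pattern E =P fpat ss) => [->|]; rewrite ?eqxx ?andbF.
  apply: subseq_pairwise (verts_pairwise (Node ts)).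
  by rewrite vertsE.
rewrite map_pattern_fsubseqs count_map; apply: eq_count => f.
exact: (inj_eq fpat_inj).
Qed.

(** * Full binary trees *)

(** Only [j = size f] can contribute; the range of the sum is independent of [f] so that such sums
    can be added over [f]. *)
Lemma count_cat_prefix (ts f : seq ptree) s :
  count (fun g => f ++ g == ts) s =
  \sum_(j < (size ts).+1) (f == take j ts) * count_mem (drop j ts) s.
Proof.
have [ef|nf] := eqVneq f (take (size f) ts); last first.
  rewrite big1 => [|j _]; last first.
    case: eqP => [ef|]; last by rewrite mul0n.
    move: nf; rewrite {2}ef size_take_min ef (minn_idPl _) ?eqxx // -ltnS.
    exact: ltn_ord.
  apply/eqP; rewrite -leqn0 leqNgt -has_count; apply/hasPn => g _.
  by apply: contra nf => /eqP <-; rewrite take_size_cat.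
have lf : size f < (size ts).+1 by rewrite ltnS ef size_take_min geq_minr.
rewrite (bigD1 (Ordinal lf)) //= -ef eqxx mul1n [X in _ + X]big1 ?addn0.
  by apply: eq_count => g /=; rewrite -{1}(cat_take_drop (size f) ts) -ef eqseq_cat // eqxx.
move=> j; rewrite -val_eqE /= => nj; case: eqP => // ej; move: nj.
rewrite {1}ej size_take_min (minn_idPl _) ?eqxx // -ltnS; exact: ltn_ord.
Qed.

Lemma count_allpairs_cat (ts : seq ptree) s1 s2 :
  count_mem ts [seq f ++ g | f <- s1, g <- s2] =
  \sum_(j < (size ts).+1) count_mem (take j ts) s1 * count_mem (drop j ts) s2.
Proof.
elim: s1 => [|f s1 IH] /=; first by rewrite big1.
rewrite count_cat IH count_map.
rewrite (eq_count (a2 := fun g => f ++ g == ts)) // count_cat_prefix -big_split.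
by apply: eq_bigr => j _ /=; rewrite mulnDl.
Qed.

Arguments nnodes : simpl never.

(** Counting forests instead of single trees closes the recurrence: cutting the host at its root
    splits the pattern into two forests. *)
Definition n_forest (ts : seq ptree) (T : ptree) : nat := count_mem ts (subforests T).

Definition n_split (ts : seq ptree) (T1 T2 : ptree) : nat :=
  \sum_(j < (size ts).+1) n_forest (take j ts) T1 * n_forest (drop j ts) T2.

(** The first summand avoids the root of the host; the second uses it, which is possible only for a
    single tree. *)
Lemma n_forest_node ts us : n_forest ts (Node us) =
  count_mem ts (fsubforests us) +
  (if ts is [:: Node ss] then count_mem ss (fsubforests us) else 0).
Proof.
rewrite /n_forest subforestsE count_cat addnC count_map; congr addn.
case: ts => [|[ss] [|t ts]].
- by rewrite -(count_pred0 (fsubforests us)); apply: eq_count.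
- by apply: eq_count => f; apply: (inj_eq (f := fun ss => [:: Node ss])) => x y [].
- by rewrite -(count_pred0 (fsubforests us)); apply: eq_count => f /=; apply/eqP.
Qed.

Lemma fsubforests2 T1 T2 : fsubforests [:: T1; T2] =
  [seq f ++ g | f <- subforests T1, g <- subforests T2].
Proof.
rewrite -[LHS]/([seq f ++ g | f <- subforests T1,
  g <- [seq f ++ g | f <- subforests T2, g <- [:: [::]]]]) allpairs1r allpairs_mapr.
by apply: eq_allpairs => f g; rewrite cats0.
Qed.

Lemma n_split_fsubforests ts T1 T2 :
  count_mem ts (fsubforests [:: T1; T2]) = n_split ts T1 T2.
Proof. by rewrite fsubforests2 count_allpairs_cat. Qed.

(** [k] is the number of internal nodes, so there are [2 k + 1] nodes; [h] is fuel, sufficient when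
    [k < h]. *)
Fixpoint btrees_fuel (h k : nat) : seq ptree :=
  match h, k with
  | 0, _ => [::]
  | _.+1, 0 => [:: Node [::]]
  | h'.+1, k'.+1 =>
    [seq U | i <- iota 0 k'.+1,
       U <- [seq Node [:: T1; T2] | T1 <- btrees_fuel h' i, T2 <- btrees_fuel h' (k' - i)]]
  end.

Lemma nnodes2 T1 T2 : nnodes (Node [:: T1; T2]) = (nnodes T1 + nnodes T2).+1.
Proof. by rewrite /nnodes vertsE /= cats0 size_cat !size_map. Qed.

Lemma full_binary2 T1 T2 :
  is_full_binary (Node [:: T1; T2]) = is_full_binary T1 && is_full_binary T2.
Proof. by rewrite /= andbT. Qed.

Lemma full_binary_odd T : is_full_binary T -> odd (nnodes T).
Proof.
pose Q ts := all is_full_binary ts -> all (odd \o nnodes) ts.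
apply: (@ptree_forest_ind (fun T => is_full_binary T -> odd (nnodes T)) Q) T.
- move=> [|T1 [|T2 [|? ?]]] // hQ /andP[_ /hQ /and3P[o1 o2 _]].
  by rewrite nnodes2 oddS oddD (o1 : odd (nnodes T1)) (o2 : odd (nnodes T2)).
- by [].
- by move=> t ts IH IHs /andP[/IH ot /IHs ots]; apply/andP.
Qed.

Lemma mem_btrees_fuel h k T : k < h ->
  (T \in btrees_fuel h k) = is_full_binary T && (nnodes T == k.*2.+1).
Proof.
elim: h k T => // h IH [|k] T kh.
  rewrite inE; have [->//|nT] := eqVneq T (Node [::]); apply/esym/negbTE.
  case: T nT => [[|T1 [|T2 [|? ?]]]]; rewrite ?eqxx // nnodes2 => _.
  by rewrite negb_and; apply/orP; right; case: T1.
rewrite ltnS in kh; apply/allpairsPdep/andP => [[i [U []]]|[fT /eqP nT]].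
  rewrite mem_iota => /= ik /allpairsP[[T1 T2] /= []].
  rewrite !IH; [|lia|lia] => /andP[f1 /eqP n1] /andP[f2 /eqP n2] -> ->.
  by rewrite /= f1 f2 nnodes2 n1 n2; split=> //; apply/eqP; lia.
case: T fT nT => [[|T1 [|T2 [|? ?]]]] //; rewrite nnodes2 full_binary2 => /andP[f1 f2] n12.
have o1 := odd_double_half (nnodes T1); rewrite (full_binary_odd f1) in o1.
have o2 := odd_double_half (nnodes T2); rewrite (full_binary_odd f2) in o2.
exists (nnodes T1)./2, (Node [:: T1; T2]); split=> //.
  by rewrite mem_iota; lia.
by apply/allpairsP; exists (T1, T2); split=> //=; rewrite IH ?f1 ?f2 ?andTb; lia.
Qed.

Lemma uniq_btrees_fuel h k : k < h -> uniq (btrees_fuel h k).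
Proof.
elim: h k => // h IH [|k] // kh.
have lt i : i \in iota 0 k.+1 -> i < h /\ k - i < h by rewrite mem_iota; lia.
apply: (@allpairs_uniq_dep _ _ _ (fun _ U => U)); first exact: iota_uniq.
  move=> i /lt[ih kih]; apply: allpairs_uniq; rewrite ?IH //.
  by move=> [T1 T2] [U1 U2] _ _ /= [-> ->].
move=> p q /allpairsPdep[i [U [/lt[ih _] Ui ->]]].
move=> /allpairsPdep[j [V [/lt[jh _] Vj ->]]] /= e.
case/allpairsP: Ui Vj => -[T1 T2] [+ _ eU] /allpairsP [[W1 W2] [+ _ eV]].
rewrite !mem_btrees_fuel //= => /andP[_ /eqP n1] /andP[_ /eqP n2].
move: n2 e; rewrite eU eV => n2 [e1 e2]; move: n2; rewrite -e1 n1 => -[].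
by move=> /double_inj ->; rewrite e1 e2.
Qed.

Definition btrees (k : nat) : seq ptree := btrees_fuel k.+1 k.

Lemma mem_btrees k T :
  (T \in btrees k) = is_full_binary T && (nnodes T == k.*2.+1).
Proof. exact: mem_btrees_fuel. Qed.

Lemma perm_btrees_fuel h k : k < h -> perm_eq (btrees_fuel h k) (btrees k).
Proof.
move=> kh; apply: uniq_perm => [||T]; rewrite ?uniq_btrees_fuel //.
by rewrite mem_btrees_fuel // mem_btrees.
Qed.

Lemma sum_btrees0 (V : nmodType) (f : ptree -> V) :
  (\sum_(T <- btrees 0) f T = f (Node [::]))%R.
Proof. by rewrite big_seq1. Qed.

Lemma sum_btreesS (V : nmodType) (f : ptree -> V) k :
  (\sum_(T <- btrees k.+1) f T =
   \sum_(i < k.+1) \sum_(T1 <- btrees i) \sum_(T2 <- btrees (k - i))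
     f (Node [:: T1; T2]))%R.
Proof.
rewrite /btrees -[btrees_fuel _ _]/([seq U | i <- iota 0 k.+1,
       U <- [seq Node [:: T1; T2] | T1 <- btrees_fuel k.+1 i, T2 <- btrees_fuel k.+1 (k - i)]]).
rewrite big_allpairs_dep -[iota 0 k.+1]/(index_iota 0 k.+1) big_mkord.
apply: eq_bigr => i _; rewrite big_allpairs_dep (perm_big _ (perm_btrees_fuel (ltn_ord i))).
apply: eq_bigr => T1 _; apply: perm_big; apply: perm_btrees_fuel.
by rewrite ltnS leq_subr.
Qed.

Lemma enumerates_btrees k Bn : enumerates_B k.*2.+1 Bn -> perm_eq Bn (btrees k).
Proof.
have InP (T : ptree) s : List.In T s <-> T \in s.
  elim: s => //= U s IH; rewrite in_cons; split=> [[->|/IH->]|/orP[/eqP->|/IH]].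
  - by rewrite eqxx.
  - by rewrite orbT.
  - by left.
  - by right.
case=> nd mem; apply: uniq_perm; last 1 first.
- move=> T; apply/idP/idP; rewrite mem_btrees.
    by move=> /InP/mem[-> ->]; rewrite eqxx.
  by move=> /andP[f /eqP n]; apply/InP/mem.
- by elim: nd => //= T s nT _ ->; rewrite andbT; apply/negP=> /InP.
- exact: uniq_btrees_fuel.
Qed.

(* The number of nodes plus the number of leaves. *)
Fixpoint weight (t : ptree) : nat :=
  let: Node ts := t in (maxn 1 (sumn (map weight ts))).+1.

Definition fweight (ts : seq ptree) : nat := sumn (map weight ts).

Lemma weightE ts : weight (Node ts) = (maxn 1 (fweight ts)).+1.
Proof. by []. Qed.

Lemma fweight_cons t ts : fweight (t :: ts) = weight t + fweight ts.
Proof. by []. Qed.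

Lemma weight_gt1 t : 1 < weight t.
Proof. by case: t => ts; rewrite weightE ltnS leq_maxl. Qed.

Lemma fweight_cat f g : fweight (f ++ g) = fweight f + fweight g.
Proof. by rewrite /fweight map_cat sumn_cat. Qed.

(** Dropping a root costs at least [1], and keeping it is monotone in what lies below. This makes
    the exponents of nested patterns strictly comparable. *)
Lemma fweight_subforests T f : f \in subforests T ->
  fweight f <= weight T /\ (fweight f = weight T -> f = [:: T]).
Proof.
pose P T := forall f, f \in subforests T ->
  fweight f <= weight T /\ (fweight f = weight T -> f = [:: T]).
pose Q ts := forall f, f \in fsubforests ts ->
  fweight f <= fweight ts /\ (fweight f = fweight ts -> f = ts).
apply: (@ptree_forest_ind P Q) T f => [ts IH f|f|t ts IH IHs f].
- rewrite subforestsE mem_cat weightE => /orP[/mapP[g /IH[le eq] ->]|/IH[le eq]].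
    rewrite fweight_cons weightE addn0; split; first by lia.
    (* [maxn 1] blurs the values [0] and [1], but a nonempty forest has [fweight] at least [2], so
       equal maxima still force equal forests. *)
    case: g le eq => [|u g] le eq; last first.
      by have := weight_gt1 u; move=> u1 e; rewrite eq //; move: e le; rewrite !fweight_cons; lia.
    case: ts {IH} eq le => [//|t ts] _ _; rewrite fweight_cons => e.
    by have := weight_gt1 t; have : 2 = (maxn 1 (weight t + fweight ts)).+1 := e; lia.
  by split; lia.
- by rewrite inE => /eqP->; split.
- case/allpairsP=> [[g h] /= [/IH [lg eg] /IHs [lh eh] ->]].
  rewrite fweight_cat fweight_cons; split=> [|e]; first by lia.
  have /eg -> : fweight g = weight t by lia.
  by have /eh -> : fweight h = fweight ts by lia.
Qed.

Lemma contained_weight S T : contained S T ->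
  weight S <= weight T /\ (weight S = weight T -> S = T).
Proof.
rewrite /contained n_embE -has_count has_pred1 => /fweight_subforests.
rewrite fweight_cons addn0 => -[le eq]; by split=> // /eq [].
Qed.

(** * Formal power series *)

Local Open Scope ring_scope.

Definition fps := nat -> rat.

HB.instance Definition _ := gen_eqMixin fps.
HB.instance Definition _ := gen_choiceMixin fps.

Implicit Types f g h : fps.

Definition fps_add f g : fps := fun n => f n + g n.
Definition fps_opp f : fps := fun n => - f n.
Definition fps_mul f g : fps := fun n => \sum_(i < n.+1) f i * g (n - i)%N.
Definition fpsC (c : rat) : fps := fun n => if n is 0 then c else 0.
Definition fpsX : fps := fun n => (n == 1)%:R.

Lemma fps_addA : associative fps_add.
Proof. by move=> f g h; apply/funext => n; apply: addrA. Qed.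
Lemma fps_addC : commutative fps_add.
Proof. by move=> f g; apply/funext => n; apply: addrC. Qed.
Lemma fps_add0 : left_id (fpsC 0) fps_add.
Proof. by move=> f; apply/funext => -[|n]; apply: add0r. Qed.
Lemma fps_addN : left_inverse (fpsC 0) fps_opp fps_add.
Proof. by move=> f; apply/funext => -[|n]; apply: addNr. Qed.

HB.instance Definition _ := GRing.isZmodule.Build fps fps_addA fps_addC fps_add0 fps_addN.

(** Low coefficients of a product are those of truncated polynomials, from which the ring laws are
    inherited. *)
Lemma fps_mul_poly N f g n : (n < N)%N ->
  fps_mul f g n = ((\poly_(i < N) f i) * (\poly_(i < N) g i))`_n.
Proof.
move=> nN; rewrite coefM; apply: eq_bigr => i _; rewrite !coef_poly.
by rewrite (leq_ltn_trans (leq_subr _ _) nN) (leq_ltn_trans _ nN) // -ltnS.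
Qed.

Lemma fps_poly_mul N f g n : (n < N)%N ->
  (\poly_(i < N) fps_mul f g i)`_n = ((\poly_(i < N) f i) * (\poly_(i < N) g i))`_n.
Proof. by move=> nN; rewrite coef_poly nN (fps_mul_poly _ _ nN). Qed.

Lemma fps_mulA : associative fps_mul.
Proof.
move=> f g h; apply/funext => n; rewrite !(fps_mul_poly (N := n.+1)) //.
transitivity (((\poly_(i < n.+1) f i) *
  ((\poly_(i < n.+1) g i) * (\poly_(i < n.+1) h i)))`_n).
  by rewrite !coefM; apply: eq_bigr => i _; rewrite fps_poly_mul // ltnS leq_subr.
by rewrite mulrA !coefM; apply: eq_bigr => i _; rewrite fps_poly_mul.
Qed.
Lemma fps_mulC : commutative fps_mul.
Proof.
by move=> f g; apply/funext => n; rewrite !(fps_mul_poly (N := n.+1)) // mulrC.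
Qed.
Lemma fps_mul1 : left_id (fpsC 1) fps_mul.
Proof.
move=> f; apply/funext => n; rewrite /fps_mul big_ord_recl mul1r subn0 big1 ?addr0 //.
by move=> i _; rewrite mul0r.
Qed.
Lemma fps_mulDl : left_distributive fps_mul fps_add.
Proof.
move=> f g h; apply/funext => n; rewrite /fps_mul /fps_add -big_split.
by apply: eq_bigr => i _; rewrite mulrDl.
Qed.
Lemma fps_1neq0 : fpsC 1 != 0.
Proof. by apply/eqP => /(congr1 (fun f => f 0%N)). Qed.

HB.instance Definition _ := GRing.Zmodule_isComNzRing.Build fps
  fps_mulA fps_mulC fps_mul1 fps_mulDl fps_1neq0.

Lemma fpsD f g n : (f + g) n = f n + g n. Proof. by []. Qed.
Lemma fpsB f g n : (f - g) n = f n - g n. Proof. by []. Qed.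
Lemma fpsM f g n : (f * g) n = \sum_(i < n.+1) f i * g (n - i)%N. Proof. by []. Qed.
Lemma fps0 n : (0 : fps) n = 0. Proof. by case: n. Qed.

Lemma fps_sum (I : Type) (r : seq I) (P : pred I) (F : I -> fps) n :
  (\sum_(i <- r | P i) F i) n = \sum_(i <- r | P i) F i n.
Proof. by apply: (big_morph (fun f => f n)) => //; rewrite fps0. Qed.

Lemma fpsCM c f n : (fpsC c * f) n = c * f n.
Proof.
rewrite fpsM big_ord_recl subn0 big1 ?addr0 // => i _; by rewrite mul0r.
Qed.

Lemma fpsC_mul c d : fpsC (c * d) = fpsC c * fpsC d.
Proof. by apply/funext => -[|n]; rewrite fpsCM //= mulr0. Qed.

Lemma fpsC_add c d : fpsC (c + d) = fpsC c + fpsC d.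
Proof. by apply/funext => -[|n]; rewrite fpsD //= addr0. Qed.

Lemma fpsXM0 f : (fpsX * f) 0%N = 0.
Proof. by rewrite fpsM big_ord1 mul0r. Qed.

Lemma fpsXMS f n : (fpsX * f) n.+1 = f n.
Proof.
rewrite fpsM !big_ord_recl mul0r add0r mul1r subn1 big1 ?addr0 // => i _.
by rewrite mul0r.
Qed.

(** Once the lower coefficients of [f] vanish, coefficient [n] of the product is [f n * g 0]. *)
Lemma fps_mulf_eq0 f g : g 0%N != 0 -> f * g = 0 -> f = 0.
Proof.
move=> g0 fg; apply/funext => n; rewrite fps0.
elim/ltn_ind: n => n IH; have := congr1 (fun f => f n) fg.
rewrite fps0 fpsM big_ord_recr /= subnn big1 ?add0r => [/eqP|i _].
  by rewrite mulf_eq0 (negbTE g0) orbF => /eqP.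
by rewrite IH ?mul0r.
Qed.

(* The coefficients of [(1 - 4 x) ^ (- a / 2)]. *)
Definition powc (a : rat) : fps :=
  fun n => \prod_(i < n) (2 * (a + 2 * i%:R) / i.+1%:R).

Lemma powc0 a : powc a 0%N = 1.
Proof. by rewrite /powc big_ord0. Qed.

(** The coefficient form of the differential equation [(1 - 4 x) f' = 2 a f]. *)
Lemma powcS a n : n.+1%:R * powc a n.+1 = 2 * (a + 2 * n%:R) * powc a n.
Proof.
rewrite {1}/powc big_ord_recr -/(powc a n) /=.
by field; rewrite ?natr1 ?nat1r pnatr_eq0.
Qed.

Lemma powcD a b : powc a * powc b = powc (a + b).
Proof.
apply/funext; elim=> [|n IH]; first by rewrite fpsM big_ord1 !powc0 mulr1.
apply: (mulfI (x := n.+1%:R)); first by rewrite pnatr_eq0.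
rewrite powcS -IH !fpsM !mulr_sumr.
(* Leibniz rule, with [n + 1 = i + (n + 1 - i)]. After a shift the two sums combine, as [2 (a + 2 i)
   + 2 (b + 2 (n - i)) = 2 (a + b + 2 n)] is free of [i]. *)
transitivity (\sum_(i < n.+2) (i%:R * powc a i) * powc b (n.+1 - i)%N +
              \sum_(i < n.+2) powc a i * ((n.+1 - i)%:R * powc b (n.+1 - i)%N)).
  rewrite -big_split; apply: eq_bigr => i _ /=.
  by rewrite natrB -1?ltnS //; ring.
rewrite big_ord_recl !mul0r add0r [X in _ + X]big_ord_recr /= subnn mul0r mulr0 addr0.
rewrite -big_split; apply: eq_bigr => i _ /=.
rewrite /bump /= subSS subSn -1?ltnS // !add1n !powcS natrB -1?ltnS //.
by ring.
Qed.

Lemma powc_0 : powc 0 = 1.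
Proof.
apply/funext => -[|n]; rewrite ?powc0 // /powc big_ord_recl addr0 mulr0 mul0r mul0r.
by [].
Qed.

Lemma powcN2 : powc (- 2) = 1 - fpsC 4 * fpsX.
Proof.
apply/funext => -[|[|n]]; rewrite fpsB fpsCM /powc.
- by rewrite big_ord0.
- by rewrite big_ord1; apply/eqP.
- by rewrite !big_ord_recl /= addrN !(mulr0, mul0r).
Qed.

(** * Generating functions of embeddings *)

(* [gf [:: S]] counts all embeddings of [S]. *)
Definition gf (ts : seq ptree) : fps :=
  fun k => \sum_(T <- btrees k) (n_forest ts T)%:R.

Definition ggf (S : ptree) : fps :=
  fun k => \sum_(T <- btrees k) (n_good_emb S T)%:R.

(** Adding the root of the host to an embedding of [ts] that avoids it gives a good embedding of
    [Node ts]. *)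
Lemma gfE ts : gf ts = ggf (Node ts) + (if ts is [:: t] then ggf t else 0).
Proof.
have n_forestE T : (n_forest ts T =
    n_good_emb (Node ts) T + (if ts is [:: t] then n_good_emb t T else 0))%N.
  case: T => us; rewrite n_forest_node n_good_embE; congr addn.
  by case: ts => [|[ss] [|? ?]] //; rewrite n_good_embE.
apply/funext => k; rewrite fpsD /gf /ggf.
transitivity (\sum_(T <- btrees k) (n_good_emb (Node ts) T)%:R +
   \sum_(T <- btrees k) (if ts is [:: t] then n_good_emb t T else 0)%:R : rat).
  by rewrite -big_split; apply: eq_bigr => T _; rewrite n_forestE natrD.
by congr (_ + _); case: ts {n_forestE} => [|S [|? ?]] //; rewrite big1 // fps0.
Qed.

(** [fpsX] marks the root of the host as internal, and its two subtrees share [ts] from left to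
    right. The [1] is the host with one node. *)
Lemma ggfE ts : ggf (Node ts) = (if ts is [::] then 1 else 0) +
  fpsX * \sum_(j < (size ts).+1) gf (take j ts) * gf (drop j ts).
Proof.
apply/funext => -[|k]; rewrite fpsD /ggf.
  rewrite sum_btrees0 n_good_embE fpsXM0 addr0 /=.
  by case: ts.
rewrite sum_btreesS fpsXMS (_ : (if ts is [::] then 1 else 0 : fps) k.+1 = 0) ?add0r; last first.
  by case: ts => //; rewrite fps0.
rewrite fps_sum.
under [RHS]eq_bigr => j _ do rewrite fpsM.
rewrite [RHS]exchange_big; apply: eq_bigr => i _ /=; rewrite /gf.
under [RHS]eq_bigr => j _ do rewrite mulr_suml.
rewrite [RHS]exchange_big; apply: eq_bigr => T1 _ /=.
under [RHS]eq_bigr => j _ do rewrite mulr_sumr.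
rewrite [RHS]exchange_big; apply: eq_bigr => T2 _ /=.
rewrite n_good_embE n_split_fsubforests natr_sum; apply: eq_bigr => j _.
by rewrite natrM.
Qed.

(** The empty forest embeds once into each tree, so this is the Catalan equation. *)
Lemma gf_nil : gf [::] = 1 + fpsX * (gf [::] * gf [::]).
Proof. by rewrite {1}gfE addr0 ggfE big_ord1. Qed.

(* The square root of [1 - 4 x] with constant coefficient [1] is unique. *)
Lemma powcN1 : powc (- 1) = 1 - fpsC 2 * fpsX * gf [::].
Proof.
set s := 1 - _; apply/eqP; rewrite -subr_eq0; apply/eqP.
(* The sum of the two roots has constant coefficient [2], so it can be cancelled from the difference
   of squares. *)
apply: (@fps_mulf_eq0 _ (powc (- 1) + s)).
  by rewrite fpsD powc0 /s fpsB -mulrA fpsCM fpsXM0.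
have -> : (powc (- 1) - s) * (powc (- 1) + s) = powc (- 1) * powc (- 1) - s * s by ring.
rewrite powcD (_ : - 1 + - 1 = - 2 :> rat) // powcN2.
rewrite (_ : s * s = 1 - fpsC 4 * fpsX * (gf [::] - fpsX * (gf [::] * gf [::]))); last first.
  by rewrite /s (_ : 4 = 2 * 2 :> rat) // fpsC_mul (_ : 2 = 1 + 1 :> rat) // fpsC_add
    (_ : fpsC 1 = 1) //; ring.
by rewrite {1}gf_nil; ring.
Qed.

(** An embedding that avoids the root lies in one of the two subtrees, the other being arbitrary.
    Moving this term, [2 x gf [::] gf [:: S]], to the left yields the factor [powc (- 1)]. *)
Lemma gf1 S : gf [:: S] = powc 1 * ggf S.
Proof.
have e : powc (- 1) * gf [:: S] = ggf S.
  rewrite powcN1 mulrBl mul1r {1}gfE ggfE !big_ord_recl big_ord0 /= add0r.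
  by rewrite (_ : 2 = 1 + 1 :> rat) // fpsC_add (_ : fpsC 1 = 1) //; ring.
by rewrite -e mulrA powcD subrr powc_0 mul1r.
Qed.

(** The two splits with an empty side are absorbed into [powc (- 1)]; the proper splits remain. *)
Lemma powcN1_gf ts : (1 < size ts)%N ->
  powc (- 1) * gf ts =
  fpsX * \sum_(j < (size ts).-1) gf (take j.+1 ts) * gf (drop j.+1 ts).
Proof.
case sz: (size ts) => [|[|n]] // _; rewrite powcN1 mulrBl mul1r {1}gfE ggfE.
rewrite (_ : (if ts is [::] then _ else _) = 0); last by case: (ts) sz.
rewrite (_ : (if ts is [:: _] then _ else _) = 0); last by case: (ts) sz => [|? []].
rewrite sz big_ord_recl big_ord_recr /= take0 drop0 /bump /= add1n -sz take_size drop_size.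
under eq_bigr => j _ do rewrite /bump /= add1n.
by rewrite (_ : 2 = 1 + 1 :> rat) // fpsC_add (_ : fpsC 1 = 1) //; ring.
Qed.

(** * Monomials in [s] and [1 - s] *)

Definition pmono (a : rat) (q : nat) : fps := powc a * (1 - powc (- 1)) ^+ q.

(** [K > 0] makes this stable under addition: constants cannot cancel. *)
Definition is_mono (a : rat) (q : nat) (f : fps) : Prop :=
  exists2 K : rat, 0 < K & f = fpsC K * pmono a q.

Lemma is_monoD a q f g : is_mono a q f -> is_mono a q g -> is_mono a q (f + g).
Proof.
move=> [K K0 ->] [L L0 ->]; exists (K + L); first exact: addr_gt0.
by rewrite fpsC_add mulrDl.
Qed.

Lemma is_monoM a b q r f g :
  is_mono a q f -> is_mono b r g -> is_mono (a + b) (q + r) (f * g).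
Proof.
move=> [K K0 ->] [L L0 ->]; exists (K * L); first exact: mulr_gt0.
by rewrite fpsC_mul /pmono -powcD exprD; ring.
Qed.

Lemma is_mono_powcM a b q f : is_mono a q f -> is_mono (b + a) q (powc b * f).
Proof. by move=> [K K0 ->]; exists K => //; rewrite /pmono -powcD; ring. Qed.

Lemma is_mono_sum a q n (F : 'I_n.+1 -> fps) :
  (forall i, is_mono a q (F i)) -> is_mono a q (\sum_i F i).
Proof.
elim: n F => [|n IH] F h; first by rewrite big_ord1.
by rewrite big_ord_recl; apply: is_monoD => //; apply: IH.
Qed.

(* The exponent [q] of [1 - s]. *)
Fixpoint unary_leaf_count (t : ptree) : nat :=
  let: Node ts := t in ((size ts <= 1) + sumn (map unary_leaf_count ts))%N.

Definition funary_leaf_count (ts : seq ptree) : nat := sumn (map unary_leaf_count ts).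

Definition good_is_mono (S : ptree) : Prop :=
  is_mono ((weight S)%:R - 2) (unary_leaf_count S) (fpsX * ggf S).

Lemma gf1_is_mono S : good_is_mono S ->
  is_mono ((weight S)%:R - 1) (unary_leaf_count S) (fpsX * gf [:: S]).
Proof.
move=> /(is_mono_powcM 1); rewrite (_ : 1 + _ = (weight S)%:R - 1); last by ring.
by rewrite mulrCA -gf1.
Qed.

(** [fweight] and [funary_leaf_count] are additive, so all proper splits of [ts] give the same
    exponents and their sum is again a monomial. *)
Lemma gf_is_mono ts : ts != [::] -> (forall S, S \in ts -> good_is_mono S) ->
  is_mono ((fweight ts)%:R - 1) (funary_leaf_count ts) (fpsX * gf ts).
Proof.
have [n] := ubnP (size ts); elim: n ts => // n IH ts lts ts0 hts.
case: (ltngtP (size ts) 1) => [|ts1|ts1]; first by case: (ts) ts0.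
  suff : is_mono ((fweight ts)%:R - 2) (funary_leaf_count ts)
      (powc (- 1) * (fpsX * gf ts)).
    move=> /(is_mono_powcM 1); rewrite mulrA powcD subrr powc_0 mul1r.
    by rewrite (_ : 1 + _ = (fweight ts)%:R - 1); last by ring.
  (* Together with the [fpsX] of the recurrence there is one factor [fpsX] for each of the two
     parts. *)
  rewrite mulrCA powcN1_gf // mulr_sumr mulr_sumr.
  have -> : (size ts).-1 = (size ts).-2.+1 by lia.
  apply: is_mono_sum => i; have li := ltn_ord i.
  have h1 : is_mono ((fweight (take i.+1 ts))%:R - 1)
      (funary_leaf_count (take i.+1 ts)) (fpsX * gf (take i.+1 ts)).
    apply: IH => [||S /mem_take/hts //]; rewrite -?size_eq0 size_takel; lia.
  have h2 : is_mono ((fweight (drop i.+1 ts))%:R - 1)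
      (funary_leaf_count (drop i.+1 ts)) (fpsX * gf (drop i.+1 ts)).
    apply: IH => [||S /mem_drop/hts //]; rewrite -?size_eq0 size_drop; lia.
  have := is_monoM h1 h2.
  have -> : fweight ts = (fweight (take i.+1 ts) + fweight (drop i.+1 ts))%N.
    by rewrite -fweight_cat cat_take_drop.
  have -> : funary_leaf_count ts =
     (funary_leaf_count (take i.+1 ts) + funary_leaf_count (drop i.+1 ts))%N.
    by rewrite /funary_leaf_count -sumn_cat -map_cat cat_take_drop.
  rewrite natrD => h.
  rewrite (_ : _ - 2 = (fweight (take i.+1 ts))%:R - 1 +
     ((fweight (drop i.+1 ts))%:R - 1)); last by ring.
  rewrite [X in is_mono _ _ X](_ : _ =
    fpsX * gf (take i.+1 ts) * (fpsX * gf (drop i.+1 ts))) //.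
  by rewrite [RHS]mulrACA -[RHS]mulrA.
case: ts ts1 hts {IH lts ts0} => [|S [|? ?]] // _ /(_ S (mem_head _ _)) /gf1_is_mono.
by rewrite fweight_cons addn0 /funary_leaf_count /= addn0.
Qed.

Lemma ggf_leaf : fpsX * ggf (Node [::]) = fpsC (1 / 2) * pmono 0 1.
Proof.
have -> : ggf (Node [::]) = gf [::] by rewrite gfE addr0.
have e : fpsC (1 / 2) * fpsC 2 = 1 by rewrite -fpsC_mul; congr fpsC.
rewrite /pmono expr1 powc_0 powcN1 mul1r -[LHS]mul1r -{1}e; ring.
Qed.

(** With two or more children, [ggf (Node ts)] is [gf ts]. With one child [T] it is [gf [:: T] - ggf
    T], that is [(1 - s) gf [:: T]], and a leaf gives [(1 - s) / (2 x)]; hence one factor [1 - s]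
    for each node with at most one child. *)
Lemma ggf_is_mono S : good_is_mono S.
Proof.
pose Q (ts : seq ptree) := forall S : ptree, S \in ts -> good_is_mono S.
apply: (@ptree_forest_ind good_is_mono Q _ _ _ S) => [ts IH|//|t ts IH IHs U]; last first.
  by rewrite in_cons => /orP[/eqP->|/IHs].
case: (ts =P [::]) IH => [-> _|/eqP ts0 IH].
  by rewrite /good_is_mono subrr; exists (1 / 2) => //; exact: ggf_leaf.
have h := gf_is_mono ts0 IH.
rewrite /good_is_mono.
have -> : (weight (Node ts))%:R - 2 = (fweight ts)%:R - 1 :> rat.
  have f0 : (0 < fweight ts)%N.
    case: (ts) ts0 => // t us _; rewrite fweight_cons; have := weight_gt1 t; lia.
  by rewrite weightE (maxn_idPr f0) -natr1; ring.
have -> : unary_leaf_count (Node ts) = ((size ts <= 1) + funary_leaf_count ts)%N by [].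
case: (leqP (size ts) 1) => ts1; last first.
  by move: h; rewrite [gf ts]gfE; case: (ts) ts1 => [|? [|? ?]] // _; rewrite addr0.
case: ts ts1 ts0 h {IH} => [|T [|? ?]] // _ _ [K K0 e]; exists K => //.
have -> : ggf (Node [:: T]) = (1 - powc (- 1)) * gf [:: T].
  rewrite mulrBl mul1r {2}gf1 mulrA powcD addNr powc_0 mul1r {1}gfE.
  by rewrite addrK.
by rewrite mulrCA e /pmono exprD expr1; ring.
Qed.

(** * Asymptotics *)

Definition eventually (P : nat -> Prop) : Prop :=
  exists N : nat, forall n : nat, (N <= n)%N -> P n.

Lemma eventuallyI (P Q R : nat -> Prop) :
  (forall n, P n -> Q n -> R n) -> eventually P -> eventually Q -> eventually R.
Proof.
move=> h [M hM] [N hN]; exists (maxn M N) => n; rewrite geq_max => /andP[Mn Nn].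
by apply: h; [exact: hM | exact: hN].
Qed.

Lemma eventually_ge (x : rat) : eventually (fun n => x <= n%:R).
Proof.
exists (Num.bound `|x|) => n hn; apply: le_trans (ler_norm x) _.
by apply: le_trans (ltW (archi_boundP (normr_ge0 x))) _; rewrite ler_nat.
Qed.

Definition little_o (f g : fps) : Prop :=
  forall e : rat, 0 < e -> eventually (fun n => `|f n| <= e * `|g n|).

Lemma little_oB f1 f2 g : little_o f1 g -> little_o f2 g -> little_o (f1 - f2) g.
Proof.
move=> h1 h2 e e0; have e2 : 0 < e / 2 by lra.
apply: eventuallyI (h1 _ e2) (h2 _ e2) => n l1 l2.
by rewrite fpsB; apply: le_trans (ler_normB _ _) _; lra.
Qed.

Lemma little_o_trans g f h : little_o f g -> little_o g h -> little_o f h.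
Proof.
move=> fg gh e e0; apply: eventuallyI (fg 1 ltr01) (gh e e0) => n; rewrite mul1r.
exact: le_trans.
Qed.

Lemma powc_gt0 a n : 0 < a -> 0 < powc a n.
Proof.
move=> a0; apply: prodr_gt0 => i _; rewrite divr_gt0 ?ltr0n //.
by rewrite mulr_gt0 // ltr_wpDr // mulr_ge0.
Qed.

Lemma powc_ge0 a n : 0 <= a -> 0 <= powc a n.
Proof.
move=> a0; apply: prodr_ge0 => i _; rewrite divr_ge0 ?ler0n //.
by rewrite mulr_ge0 // addr_ge0 // mulr_ge0.
Qed.

(** Passing from [a] to [a + 2] shifts the product by one factor, so only the end factors differ.
    The form without division also covers exponents [a <= 0]. *)
Lemma powcD2 a n : powc a n * (a + 2 * n%:R) = a * powc (a + 2) n.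
Proof.
elim: n => [|n IH]; first by rewrite !powc0; ring.
apply: (mulfI (x := n.+1%:R)); first by rewrite pnatr_eq0.
rewrite mulrA powcS [RHS]mulrCA powcS.
transitivity (2 * (powc a n * (a + 2 * n%:R)) * (a + 2 * n.+1%:R)); first by ring.
by rewrite IH -natr1; ring.
Qed.

Lemma powc_little_o2 a : little_o (powc a) (powc (a + 2)).
Proof.
move=> e e0.
(* Chosen so that [a + 2 n] exceeds [|a| / e], the bound that [powcD2] asks for. *)
have [N hN] := eventually_ge ((`|a| / e + `|a| + 1) / 2).
exists N => n /hN h.
have h1 : `|a| / e + 1 <= a + 2 * n%:R.
  by have := ler_norm (- a); rewrite normrN; lra.
have ae : 0 <= `|a| / e by rewrite divr_ge0 // ltW.
have p : 0 < a + 2 * n%:R by lra.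
rewrite -(ler_pM2r p) -{1}(gtr0_norm p) -normrM powcD2 normrM.
rewrite -mulrA [X in _ <= e * X]mulrC mulrA ler_wpM2r //.
rewrite mulrC -ler_pdivrMr //; lra.
Qed.

(* The factor [a ^ 2 / (a ^ 2 - 1)] is the contribution of [i = 0] to the
   product of the [(a + 2 i) ^ 2 / ((a + 2 i) ^ 2 - 1)]. *)
Lemma powc_log_concave_gap a n : 1 <= a -> (0 < n)%N ->
  a ^+ 2 * (powc (a - 1) n * powc (a + 1) n) <= (a ^+ 2 - 1) * powc a n ^+ 2.
Proof.
(* The case [n = 1] is an equality. Up to a common factor, each step multiplies the left side by
   [(a + 2 k)^2 - 1] and the right side by [(a + 2 k)^2]. *)
move=> a1; case: n => // n _; elim: n => [|n IH].
  by rewrite /powc !big_ord1 /= mulr0 !addr0 !divr1 [leLHS](_ : _ =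
    (a ^+ 2 - 1) * (2 * a) ^+ 2) //; ring.
have n0 : 0 < n.+2%:R ^+ 2 :> rat by rewrite exprn_gt0.
rewrite -(ler_pM2l n0).
have -> : n.+2%:R ^+ 2 * (a ^+ 2 * (powc (a - 1) n.+2 * powc (a + 1) n.+2)) =
  a ^+ 2 * ((n.+2%:R * powc (a - 1) n.+2) * (n.+2%:R * powc (a + 1) n.+2)) by ring.
have -> : n.+2%:R ^+ 2 * ((a ^+ 2 - 1) * powc a n.+2 ^+ 2) =
  (a ^+ 2 - 1) * (n.+2%:R * powc a n.+2) ^+ 2 by ring.
rewrite !powcS.
set k : rat := n.+1%:R; have k0 : 0 <= k by rewrite ler0n.
have c0 : 0 <= (a ^+ 2 - 1) * powc a n.+1 ^+ 2.
  by rewrite mulr_ge0 ?sqr_ge0 // subr_ge0 exprn_ege1.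
set u := powc (a - 1) n.+1 in IH *; set v := powc (a + 1) n.+1 in IH *.
have -> : a ^+ 2 * (2 * (a - 1 + 2 * k) * u * (2 * (a + 1 + 2 * k) * v)) =
  4 * ((a + 2 * k) ^+ 2 - 1) * (a ^+ 2 * (u * v)) by ring.
have -> : (a ^+ 2 - 1) * (2 * (a + 2 * k) * powc a n.+1) ^+ 2 =
  4 * (a + 2 * k) ^+ 2 * ((a ^+ 2 - 1) * powc a n.+1 ^+ 2) by ring.
have m0 : 0 <= 4 * ((a + 2 * k) ^+ 2 - 1).
  by rewrite mulr_ge0 // subr_ge0 exprn_ege1 //; lra.
apply: le_trans (ler_wpM2l m0 IH) _.
by rewrite ler_wpM2r //; lra.
Qed.

Lemma powc_log_concave a n : 1 <= a ->
  powc (a - 1) n * powc (a + 1) n <= powc a n ^+ 2.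
Proof.
move=> a1; case: n => [|n]; first by rewrite !powc0; lra.
have := powc_log_concave_gap a1 (ltn0Sn n).
have a2 : 0 < a ^+ 2 by rewrite exprn_gt0 //; lra.
move=> h; rewrite -(ler_pM2l a2); apply: le_trans h _.
by rewrite ler_wpM2r ?sqr_ge0 //; lra.
Qed.

(** With [c_b] for [powc b n], log-concavity halves a step of [2]: [c_(a-1)^2 <= e^2 c_(a-1) c_(a+1)
    <= e^2 c_a^2]. *)
Lemma powc_little_o1 a : 1 <= a -> little_o (powc (a - 1)) (powc a).
Proof.
move=> a1 e e0; have e2 : 0 < e ^+ 2 by rewrite exprn_gt0.
have [N hN] := @powc_little_o2 (a - 1) _ e2; exists N => n /hN.
have -> : a - 1 + 2 = a + 1 by ring.
have u0 : 0 <= powc (a - 1) n by apply: powc_ge0; lra.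
have v0 : 0 <= powc (a + 1) n by apply: powc_ge0; lra.
have w0 : 0 <= powc a n by apply: powc_ge0; lra.
rewrite !ger0_norm // => h.
rewrite -(@ler_pXn2r _ 2) ?nnegrE ?mulr_ge0 //; last exact: ltW.
rewrite exprMn expr2; apply: le_trans (ler_wpM2l u0 h) _.
rewrite mulrCA; apply: ler_wpM2l; first exact: ltW.
exact: powc_log_concave.
Qed.

Lemma powc_little_o a d : 1 <= a -> little_o (powc (a - d.+1%:R)) (powc a).
Proof.
(* Below exponent [1] only steps of [2] are available, so two consecutive cases are carried
   along. *)
move=> a1; suff [//] : little_o (powc (a - d.+1%:R)) (powc a) /\
  little_o (powc (a - d.+2%:R)) (powc a).
elim: d => [|d [IH1 IH2]].
  split; first exact: powc_little_o1.
  by rewrite -{2}[a](subrK 2); exact: powc_little_o2.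
split=> //; apply: little_o_trans IH1.
have -> : a - d.+1%:R = a - d.+3%:R + 2 by ring.
exact: powc_little_o2.
Qed.

(** * Asymptotics of the monomials *)

Lemma pmono0 a : pmono a 0 = powc a.
Proof. by rewrite /pmono expr0 mulr1. Qed.

Lemma pmonoS a q : pmono a q.+1 = pmono a q - pmono (a - 1) q.
Proof. by rewrite /pmono exprS -powcD; ring. Qed.

Lemma pmono_little_o a d q : 1 <= a -> little_o (pmono (a - d.+1%:R) q) (powc a).
Proof.
move=> a1; elim: q d => [|q IH] d; first by rewrite pmono0; exact: powc_little_o.
rewrite pmonoS; apply: little_oB => //.
have -> : a - d.+1%:R - 1 = a - d.+2%:R by ring.
exact: IH.
Qed.

(** In the expansion of [(1 - s)^q], every term but the leading one lowers the exponent by a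
    positive integer. *)
Lemma pmono_equiv a q : 1 <= a -> little_o (pmono a q - powc a) (powc a).
Proof.
move=> a1; elim: q => [|q IH].
  by rewrite pmono0 subrr => e e0; exists 0%N => n _; rewrite fps0 normr0 mulr_ge0 // ltW.
rewrite pmonoS addrAC; apply: little_oB => //.
exact: (@pmono_little_o a 0).
Qed.

Lemma pmono_bounds a q e : 1 <= a -> 0 < e ->
  eventually (fun n => (1 - e) * powc a n <= pmono a q n <= (1 + e) * powc a n).
Proof.
move=> a1 /(pmono_equiv q a1) [N hN]; exists N => n /hN.
have c0 : 0 < powc a n by apply: powc_gt0; lra.
by rewrite fpsB (gtr0_norm c0) ler_distl => /andP[l r]; apply/andP; split; lra.
Qed.

(** The gap is gained at [d = 0]. It then persists, because log-concavity makes the quotient of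
    [powc b n] by [powc (b + 1) n] nondecreasing in [b]. *)
Lemma powc_ratio a d n : 2 <= a -> (0 < n)%N ->
  a ^+ 2 * (powc (a - 1) n * powc (a + d.+1%:R) n) <=
  (a ^+ 2 - 1) * (powc (a + d%:R) n * powc a n).
Proof.
move=> a2 n0; elim: d => [|d IH].
  by rewrite addr0 -expr2; apply: powc_log_concave_gap => //; lra.
have d0 : 0 <= d%:R :> rat by rewrite ler0n.
have := @powc_log_concave (a + d.+1%:R) n; rewrite -addrA -!natr1 -!addrA subrr addr0.
rewrite -(natr1 d) in IH.
have pos b : 1 <= b -> 0 < powc b n by move=> b1; apply: powc_gt0; lra.
set u := powc (a - 1) n in IH *; set v := powc a n in IH *.
set x := powc (a + d%:R) n in IH *; set y := powc _ n in IH *.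
set w := powc _ n => h.
have {}h : x * w <= y ^+ 2 by apply: h; lra.
have x0 : 0 < x by apply: pos; lra.
have y0 : 0 < y by apply: pos; lra.
have u0 : 0 < u by apply: pos; lra.
rewrite -(ler_pM2l x0).
have := ler_wpM2l (ltW y0) IH.
have := ler_wpM2l (mulr_ge0 (sqr_ge0 a) (ltW u0)) h.
lra.
Qed.

(** All four exponents are at least [1], so each [pmono] is close to its [powc], and the gap of
    [powc_ratio] absorbs the four errors. *)
Lemma pmono_ratio a d q r : 2 <= a ->
  eventually (fun n => pmono (a - 1) q n * pmono (a + d.+1%:R) r n <=
                       pmono (a + d%:R) r n * pmono a q n).
Proof.
move=> a2; have d0 : 0 <= d%:R :> rat by rewrite ler0n.
have s0 : 0 < a ^+ 2 by rewrite exprn_gt0 //; lra.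
(* The gap factor [1 - 1 / a^2] becomes [1 - 4 e], and [(1 - e)^2 - (1 + e)^2 (1 - 4 e) = e^2 (8 + 4
   e)] is nonnegative. *)
pose e := (4 * a ^+ 2)^-1.
have ea : 4 * a ^+ 2 * e = 1 by rewrite mulfV //; lra.
have e0 : 0 < e by rewrite invr_gt0; lra.
have e1 : 4 * e <= 1.
  have : e * 4 <= e * (4 * a ^+ 2).
    by rewrite ler_pM2l // ler_peMr // exprn_ege1 //; lra.
  lra.
clearbody e.
have b1 : eventually _ := @pmono_bounds (a - 1) q e ltac:(lra) e0.
have b2 : eventually _ := @pmono_bounds a q e ltac:(lra) e0.
have b3 : eventually _ := @pmono_bounds (a + d%:R) r e ltac:(lra) e0.
have b4 : eventually _ := @pmono_bounds (a + d.+1%:R) r e ltac:(rewrite -natr1; lra) e0.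
apply: eventuallyI (eventuallyI (fun n p q => conj p q) b1 b4)
  (eventuallyI (fun n p q => conj p q) (eventuallyI (fun n p q => conj p q) b2 b3)
    (ex_intro _ 1%N (fun n => id))) => n.
move=> [/andP[l1 r1] /andP[l4 r4]] [[/andP[l2 _] /andP[l3 _]] n0].
have := powc_ratio d a2 n0; move: l1 r1 l2 l3 l4 r4.
have pos b : 1 <= b -> 0 < powc b n by move=> b1'; apply: powc_gt0; lra.
have := pos (a - 1) ltac:(lra); have := pos a ltac:(lra).
have := pos (a + d%:R) ltac:(lra); have := pos (a + d.+1%:R) ltac:(rewrite -natr1; lra).
move: (powc (a - 1) n) (powc a n) (powc (a + d%:R) n) (powc (a + d.+1%:R) n).
move: (pmono (a - 1) q n) (pmono a q n) (pmono (a + d%:R) r n) (pmono (a + d.+1%:R) r n).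
move=> pu pv px py u v x y y0 x0 v0 u0 l1 r1 l2 l3 l4 r4 h.
have f0 : 0 <= 1 - e by lra.
have pu0 : 0 <= pu by apply: le_trans l1; rewrite mulr_ge0 // ltW.
have py0 : 0 <= py by apply: le_trans l4; rewrite mulr_ge0 // ltW.
apply: le_trans (ler_pM pu0 py0 r1 r4) _.
apply: le_trans (ler_pM (mulr_ge0 f0 (ltW x0)) (mulr_ge0 f0 (ltW v0)) l3 l2).
have {}h : u * y <= (1 - 4 * e) * (x * v).
  have := ler_wpM2l (mulr_ge0 (ler0n _ 4) (ltW e0)) h.
  have -> : 4 * e * (a ^+ 2 * (u * y)) = (4 * a ^+ 2 * e) * (u * y) by ring.
  have -> : 4 * e * ((a ^+ 2 - 1) * (x * v)) = (4 * a ^+ 2 * e - 4 * e) * (x * v) by ring.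
  by rewrite ea mul1r.
have -> : (1 + e) * u * ((1 + e) * y) = (1 + e) ^+ 2 * (u * y) by ring.
have -> : (1 - e) * x * ((1 - e) * v) = (1 - e) ^+ 2 * (x * v) by ring.
apply: le_trans (ler_wpM2l (sqr_ge0 _) h) _; rewrite mulrA ler_wpM2r //.
  by rewrite mulr_ge0 // ltW.
have : 0 <= e ^+ 2 * (8 + 4 * e) by apply: mulr_ge0 (sqr_ge0 e) _; lra.
lra.
Qed.

(* For the single vertex the numerator [pmono 0 1] has no leading term. *)
Lemma pmono_ratio_leaf d r :
  eventually (fun n => pmono 0 1 n * pmono (2 + d%:R) r n <=
                       pmono (1 + d%:R) r n * pmono 1 1 n).
Proof.
have d0 : 0 <= d%:R :> rat by rewrite ler0n.
have d1 : 1 <= 1 + d%:R :> rat by lra.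
have d2 : 1 <= 2 + d%:R :> rat by lra.
(* Then [3 e = 1 / 4], the constant of [cmc2], and [(1 + e) / 4] is below [(1 - e)^2]. *)
have [e e0 e12] : exists2 e : rat, 0 < e & e = 1 / 12.
  by exists (1 / 12); lra.
have b1 : eventually _ := @pmono_bounds 1 1 e (lexx _) e0.
have b2 : eventually _ := @pmono_bounds (1 + d%:R) r e d1 e0.
have b3 : eventually _ := @pmono_bounds (2 + d%:R) r e d2 e0.
(* [powcD2] relates the exponents [- 1], [1] and [3] exactly; this estimate brings in the exponent
   [2]. *)
have o23 : little_o (powc 2) (powc 3) := @powc_little_o1 3 isT.
have b4 : eventually _ := o23 e e0.
apply: eventuallyI (eventuallyI (fun n p q => conj p q) b1 b4)
  (eventuallyI (fun n p q => conj p q) (eventuallyI (fun n p q => conj p q) b2 b3)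
    (ex_intro _ 1%N (fun n => id))) => n.
move=> {b1 b2 b3 b4} [/andP[l1 _] h4] [[/andP[l2 _] /andP[l3 r3]] n0].
have pos b : 1 <= b -> 0 < powc b n by move=> b1; exact: powc_gt0 (lt_le_trans ltr01 b1).
have c1 := pos 1 isT; have c2 := pos 2 isT; have c3 := pos 3 isT.
have x0 := pos _ d1; have y0 := pos _ d2.
have h : powc 1 n * powc (2 + d%:R) n <= powc (1 + d%:R) n * powc 2 n.
  case: d {d0 d1 d2 l2 l3 r3} x0 y0 => [|d] x0 y0; first by rewrite !addr0 mulrC.
  have hr : 2 ^+ 2 * (powc 1 n * powc (2 + d.+1%:R) n) <=
    (2 ^+ 2 - 1) * (powc (2 + d%:R) n * powc 2 n) := powc_ratio d (lexx 2) n0.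
  rewrite (_ : 1 + d.+1%:R = 2 + d%:R) in x0 *; last by rewrite -natr1; ring.
  move: hr (mulr_ge0 (ltW x0) (ltW c2)).
  by move: (powc 1 n * _) (powc (2 + _) n * powc 2 n) => u v; lra.
have k1 : 1 <= n%:R :> rat by rewrite ler1n.
have m1 : powc (-1) n * (-1 + 2 * n%:R) = -1 * powc 1 n := powcD2 (-1) n.
have m2 : powc 1 n * (1 + 2 * n%:R) = 1 * powc 3 n := powcD2 1 n.
(* [pmono 0 1] is [1 - s], and the constant [1] is invisible at [n > 0]. *)
have -> : pmono 0 1 n = - powc (- 1) n.
  by case: (n) n0 => [//|n' _]; rewrite /pmono powc_0 expr1 mul1r fpsB sub0r.
have {h4} : powc 2 n <= e * powc 3 n.
  by move: h4; rewrite !gtr0_norm.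
move: l1 l2 l3 r3 m1 m2 h c1 c2 c3 x0 y0.
move: (powc (-1) n) (powc 1 n) (powc 2 n) (powc 3 n) => cm c1 c2 c3.
move: (powc (1 + d%:R) n) (powc (2 + d%:R) n) (n%:R : rat) k1 => x y k k1.
move: (pmono (1 + d%:R) r n) (pmono (2 + d%:R) r n) (pmono 1 1 n) => px py p1.
move=> l1 l2 l3 r3 m1 m2 h c1_0 c2_0 c3_0 x0 y0 h4.
rewrite mul1r in m2; rewrite -m2 in h4.
have cm0 : 0 <= - cm by nra.
have cmc1 : - cm * (2 * k - 1) = c1 by lra.
(* Since [k >= 1], [1 + 2 k <= 3 (2 k - 1)], and the last factor turns [- cm] into [c1]. *)
have cmc2 : - cm * c2 <= 1 / 4 * c1 ^+ 2.
  apply: le_trans (ler_wpM2l cm0 h4) _.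
  have -> : 1 / 4 * c1 ^+ 2 = - cm * (e * (c1 * (3 * (2 * k - 1)))).
    by rewrite expr2 -{1}cmc1 e12; field.
  apply: (ler_wpM2l cm0); apply: (ler_wpM2l (ltW e0)); apply: (ler_wpM2l (ltW c1_0)).
  lra.
have cmy : - cm * y <= 1 / 4 * (c1 * x).
  rewrite -(ler_pM2l c1_0).
  have := ler_wpM2l cm0 h; have := ler_wpM2r (ltW x0) cmc2; lra.
apply: le_trans (ler_wpM2l cm0 r3) _.
have f0 : 0 <= 1 - e by rewrite e12; lra.
apply: le_trans (ler_pM (mulr_ge0 f0 (ltW x0)) (mulr_ge0 f0 (ltW c1_0)) l2 l1).
have := mulr_gt0 x0 c1_0; rewrite e12; lra.
Qed.

(** * Comparison of the two ratios *)

Lemma pmono_gt0 a q : 1 <= a -> eventually (fun n => 0 < pmono a q n).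
Proof.
move=> a1; have e0 : 0 < 1 / 2 :> rat by lra.
have e1 : 0 < 1 - 1 / 2 :> rat by lra.
have [N hN] := pmono_bounds q a1 e0; exists N => n /hN /andP[l _].
have c0 := powc_gt0 n (lt_le_trans ltr01 a1).
exact: lt_le_trans (mulr_gt0 e1 c0) l.
Qed.

(** The constant [K] cancels, and the factor [fpsX] moves coefficient [k] to [k + 1]. *)
Lemma ggf_div_gf S k : ggf S k / gf [:: S] k =
  pmono ((weight S)%:R - 2) (unary_leaf_count S) k.+1 /
  pmono ((weight S)%:R - 1) (unary_leaf_count S) k.+1.
Proof.
have [K K0 e] := ggf_is_mono S.
have e' : fpsX * gf [:: S] = fpsC K * pmono ((weight S)%:R - 1) (unary_leaf_count S).
  rewrite gf1 mulrCA e mulrCA; congr (_ * _); rewrite /pmono mulrA powcD.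
  by congr (powc _ * _); ring.
rewrite -[ggf S k]fpsXMS -[gf _ k]fpsXMS e e' !fpsCM -mulf_div divff ?mul1r //.
by rewrite gt_eqF.
Qed.

Lemma ggf_div_gf_le S1 S2 : (weight S1 < weight S2)%N ->
  eventually (fun k => ggf S1 k / gf [:: S1] k <= ggf S2 k / gf [:: S2] k).
Proof.
move=> lt12; have w1 := weight_gt1 S1.
pose a1 : rat := (weight S1)%:R - 1; pose a2 : rat := (weight S2)%:R - 1.
have h1 : 1 <= a1 by rewrite /a1 lerBrDr (ler_nat _ 2).
have h2 : 1 <= a2 by rewrite /a2 lerBrDr (ler_nat _ 2) (leq_trans w1) // ltnW.
have p1 := pmono_gt0 (unary_leaf_count S1) h1.
have p2 := pmono_gt0 (unary_leaf_count S2) h2.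
have r : eventually (fun n =>
    pmono ((weight S1)%:R - 2) (unary_leaf_count S1) n * pmono a2 (unary_leaf_count S2) n <=
    pmono ((weight S2)%:R - 2) (unary_leaf_count S2) n * pmono a1 (unary_leaf_count S1) n).
  have [d ew] : exists d, weight S2 = (weight S1 + d.+1)%N.
    by exists (weight S2 - weight S1).-1; lia.
  rewrite /a1 /a2 {p1 p2 a1 a2 h1 h2} ew natrD.
  (* The remaining weight [2] is that of the single vertex, whose numerator has exponent [0],
     outside the range of [pmono_ratio]. *)
  have [w3|] := ltnP 2 (weight S1).
    have a2 : 2 <= (weight S1)%:R - 1 :> rat by rewrite lerBrDr (ler_nat _ 3).
    have := pmono_ratio d (unary_leaf_count S1) (unary_leaf_count S2) a2.
    rewrite (_ : _ - 1 - 1 = (weight S1)%:R - 2); last by ring.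
    rewrite (_ : _ - 1 + d.+1%:R = (weight S1)%:R + d.+1%:R - 1); last by ring.
    by rewrite (_ : _ - 1 + d%:R = (weight S1)%:R + d.+1%:R - 2) //; ring.
  case: S1 {lt12} w1 => -[|t ts] w1 w2; last first.
    by move: w1 w2; rewrite weightE fweight_cons; have := weight_gt1 t; lia.
  rewrite (_ : (weight (Node [::]))%:R = 2) //.
  have := pmono_ratio_leaf d (unary_leaf_count S2).
  have e1 : 1 + d%:R = 2 + d.+1%:R - 2 :> rat by rewrite -(natr1 d); ring.
  have e2 : 2 + d%:R = 2 + d.+1%:R - 1 :> rat by rewrite -(natr1 d); ring.
  by rewrite e1 e2 subrr (_ : 2 - 1 = 1).
have [N hN] := eventuallyI (fun n p q => conj p q) r (eventuallyI (fun n p q => conj p q) p1 p2).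
exists N => k Nk; have [l [y1 y2]] := hN k.+1 (leqW Nk).
by rewrite !ggf_div_gf ler_pdivrMr // mulrAC ler_pdivlMr.
Qed.

Lemma g_count_ggf k Bn S : perm_eq Bn (btrees k) -> (g_count Bn S)%:R = ggf S k.
Proof. by move=> pB; rewrite natr_sum (perm_big _ pB). Qed.

Lemma a_count_gf k Bn S : perm_eq Bn (btrees k) -> (a_count Bn S)%:R = gf [:: S] k.
Proof.
move=> pB; rewrite natr_sum (perm_big _ pB); apply: eq_bigr => T _.
by rewrite n_embE.
Qed.

Theorem theorem4 (S1 S2 : ptree) :
  contained S1 S2 ->
  exists N : nat, forall n : nat, (N <= n)%N -> odd n ->
    forall Bn : seq ptree, enumerates_B n Bn ->
      ((g_count Bn S1)%:R / (a_count Bn S1)%:R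
         <= (g_count Bn S2)%:R / (a_count Bn S2)%:R :> rat)%R.
Proof.
move=> /contained_weight [le12 eq12].
have [e|ne] := eqVneq (weight S1) (weight S2).
  by exists 0%N => n _ _ Bn _; rewrite (eq12 e).
have [N hN] : eventually (fun k => ggf S1 k / gf [:: S1] k <= ggf S2 k / gf [:: S2] k).
  by apply: ggf_div_gf_le; rewrite ltn_neqAle ne.
(* The series are indexed by the number [k] of internal nodes, and [n = 2 k + 1]. *)
exists N.*2.+1 => n Nn on Bn; have := odd_double_half n; rewrite on add1n => en.
rewrite -en => /enumerates_btrees pB.
rewrite !(g_count_ggf _ pB) !(a_count_gf _ pB); apply: hN.
by rewrite -leq_double -ltnS en.
Qed.
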